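(* Let $A,B\in\mathbb{C}^{n\times n}$ be sectorial. Then $I+AB$ is invertible if there exists $\theta\in[0,\pi)\cap\Psi(A)$ such that $$\gamma_\theta(A)\,\bar\sigma(B)<1\quad\text{and}\quad\Psi(B)\subset(-\pi+\theta,\ \pi-\theta).$$
   Context: $\bar\sigma$: largest singular value. $A$ is sectorial if $0\notin\{x^*Ax:\|x\|=1\}$; then $A=T^*DT$, $T$ nonsingular, $D$ diagonal unitary, and the phases $\bar\phi(A)\ge\dots\ge\underline\phi(A)$ are the arguments of the diagonal entries of $D$ with $\bar\phi-\underline\phi<\pi$ and $(\bar\phi+\underline\phi)/2\in(-\pi,\pi]$; $\Psi(A)=[\underline\phi(A),\bar\phi(A)]$. $\mathcal{DW}(A)=\{(\mathrm{Re}\,x^*Ax,\mathrm{Im}\,x^*Ax,\|Ax\|^2):\|x\|=1\}$. For sectorial $A$ and $\theta\in[0,\pi)\cap\Psi(A)$: $\mathcal{R}_{\ge\theta}(A)=\{h\ge0:\exists z\in\mathbb{C},\ \angle z\notin(-\theta,\theta),\ (\mathrm{Re}\,z,\mathrm{Im}\,z,h^2)\in\mathcal{DW}(A)\}$ ($\angle z\in(-\pi,\pi]$) and $\gamma_\theta(A)=\max\mathcal{R}_{\ge\theta}(A)$. *)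

(* Defs.v *)
From HB Require Import structures.
From mathcomp Require Import all_boot all_order all_algebra.
From mathcomp Require Import all_classical all_reals.
From mathcomp Require Import trigo.
From mathcomp Require Import complex.
Set Implicit Arguments. Unset Strict Implicit. Unset Printing Implicit Defensive.
Import Order.TTheory GRing.Theory Num.Theory.
Local Open Scope ring_scope.
Local Open Scope complex_scope.

Section Defs.
Variable R : realType.
Variable n : nat.
Local Notation C := R[i].

Definition ctrmx (m p : nat) (M : 'M[C]_(m, p)) : 'M[C]_(p, m) :=
  map_mx (fun z : C => (complex.Re z) -i* (complex.Im z)) M^T.

Definition qform (A : 'M[C]_n) (x : 'cV[C]_n) : C := (ctrmx x *m A *m x) 0 0.

Definition sqnorm (x : 'cV[C]_n) : C := (ctrmx x *m x) 0 0.

Definition unit_vec (x : 'cV[C]_n) : Prop := sqnorm x = 1.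

Definition numrange (A : 'M[C]_n) : set C :=
  fun z => exists x, unit_vec x /\ z = qform A x.

Definition sectorial (A : 'M[C]_n) : Prop := ~ numrange A 0.

Definition expi (phi : R) : C := cos phi +i* sin phi.

(* argument in (-pi, pi], with the convention angle 0 = 0 *)
Definition angle (z : C) : R :=
  if z == 0 then 0 else
  let r := Num.sqrt (complex.Re z ^+ 2 + complex.Im z ^+ 2) in
  if 0 <= complex.Im z then acos (complex.Re z / r)
  else - acos (complex.Re z / r).

(* phi : 'I_n -> R are the phases of A, realized by a sectorial decomposition
   A = T^* D T, T nonsingular, D = diag(e^{i phi_k}), with phi imin the
   smallest and phi imax the largest phase, phi imax - phi imin < pi and
   (phi imax + phi imin)/2 in (-pi, pi]. *)
Definition phases (A : 'M[C]_n) (phi : 'I_n -> R) (imin imax : 'I_n) : Prop :=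
  exists T : 'M[C]_n, T \in unitmx /\
    A = ctrmx T *m diag_mx (\row_k expi (phi k)) *m T /\
    (forall k, phi imin <= phi k <= phi imax) /\
    phi imax - phi imin < pi /\
    - pi < (phi imax + phi imin) / 2 <= pi.

Definition Psi (A : 'M[C]_n) : set R :=
  fun t => exists phi imin imax, phases A phi imin imax /\ phi imin <= t <= phi imax.

Definition is_sigma_max (B : 'M[C]_n) (s : R) : Prop :=
  0 <= s /\ eigenvalue (ctrmx B *m B) ((s ^+ 2)%:C) /\
  forall l, eigenvalue (ctrmx B *m B) l -> l <= (s ^+ 2)%:C.

Definition DW (A : 'M[C]_n) : set (R * R * R) :=
  fun p => exists x, unit_vec x /\
    p = (complex.Re (qform A x), complex.Im (qform A x),
         complex.Re ((ctrmx (A *m x) *m (A *m x)) 0 0)).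

Definition Rge (A : 'M[C]_n) (theta : R) : set R :=
  fun h => 0 <= h /\ exists z : C,
    ~ (- theta < angle z < theta) /\ DW A (complex.Re z, complex.Im z, h ^+ 2).

Definition is_gamma (A : 'M[C]_n) (theta g : R) : Prop :=
  Rge A theta g /\ forall h, Rge A theta h -> h <= g.

End Defs.

(* Main.v *)
Require Import Defs.
From HB Require Import structures.
From mathcomp Require Import all_boot all_order all_algebra.
From mathcomp Require Import all_classical all_reals.
From mathcomp Require Import topology normedtype derive trigo.
From mathcomp Require Import complex.
From mathcomp Require Import ring lra.
Set Implicit Arguments. Unset Strict Implicit. Unset Printing Implicit Defensive.
Import Order.TTheory GRing.Theory Num.Theory.
Import numFieldNormedType.Exports.
Local Open Scope ring_scope.
Local Open Scope complex_scope.

(* If (I + AB) y = 0 with y <> 0 and x = By, then Ax = -y, hence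
   x^*Ax = - conj (y^*By) and |x| <= sigma |y|.  The value y^*By is a nonnegative
   combination of the e^{i phi_k}, so its argument lies between the extreme phases
   of B; reflecting, the argument of x^*Ax lies outside (-theta, theta).  Thus
   |Ax| / |x| >= 1 / sigma belongs to R_{>= theta}(A), against gamma * sigma < 1.

   The phase condition on B carries information only because a sectorial matrix
   does have phases.  To see this, let w be the point of the numerical range closest
   to the origin: by the Toeplitz-Hausdorff argument, conj w * B has positive
   definite Hermitian part H.  With its skew part i K, a congruence reducing H to the
   identity and K to a real diagonal diag(l_k) turns conj w * B into
   diag(1 + i l_k), a positive diagonal matrix times diag(e^{i atan l_k}). *)

(** * Conjugate transposes, Hermitian matrices and quadratic forms *)

Section Adjoint.
Variable R : realType.
Local Notation C := R[i].

Lemma ctrmxE m p (M : 'M[C]_(m, p)) : ctrmx M = map_mx (Num.conj : C -> C) M^T.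
Proof. by apply/matrixP => i j; rewrite !mxE; case: (M j i). Qed.

Lemma ctrmx_mul m p q (M : 'M[C]_(m, p)) (N : 'M[C]_(p, q)) :
  ctrmx (M *m N) = ctrmx N *m ctrmx M.
Proof. by rewrite !ctrmxE trmx_mul map_mxM. Qed.

Lemma ctrmxK m p (M : 'M[C]_(m, p)) : ctrmx (ctrmx M) = M.
Proof. by apply/matrixP => i j; rewrite !mxE; case: (M i j) => a b /=; rewrite opprK. Qed.

Lemma ctrmxD m p (M N : 'M[C]_(m, p)) : ctrmx (M + N) = ctrmx M + ctrmx N.
Proof. by rewrite !ctrmxE linearD /= map_mxD. Qed.

Lemma ctrmxN m p (M : 'M[C]_(m, p)) : ctrmx (- M) = - ctrmx M.
Proof. by rewrite !ctrmxE linearN /= map_mxN. Qed.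

Lemma ctrmxZ m p (a : C) (M : 'M[C]_(m, p)) : ctrmx (a *: M) = conjc a *: ctrmx M.
Proof. by rewrite !ctrmxE linearZ /= map_mxZ. Qed.

Lemma ctrmx_real_diag n (d : 'rV[R]_n) :
  ctrmx (diag_mx (map_mx (real_complex R) d)) = diag_mx (map_mx (real_complex R) d).
Proof.
apply/matrixP => i j; rewrite !mxE eq_sym; case: eqP => [->|_] /=.
  by rewrite mulr1n oppr0.
by rewrite mulr0n /= oppr0.
Qed.

Lemma ctrmx_unit n (T : 'M[C]_n) : (ctrmx T \in unitmx) = (T \in unitmx).
Proof. by rewrite ctrmxE map_unitmx unitmx_tr. Qed.

Lemma ctrmx_inv n (T : 'M[C]_n) : ctrmx (invmx T) = invmx (ctrmx T).
Proof. by rewrite !ctrmxE trmx_inv map_invmx. Qed.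

(** A Hermitian matrix is normal, so the spectral theorem supplies a unitary [U]; its eigenvalues
    are real, which lets [d] be a row over [R] and later be compared with real bounds. *)
Lemma hermitian_diagonalization n (H : 'M[C]_n) : ctrmx H = H ->
  exists (U : 'M[C]_n) (d : 'rV[R]_n), U \in unitmx /\ ctrmx U *m U = 1%:M /\
    H = ctrmx U *m diag_mx (map_mx (real_complex R) d) *m U.
Proof.
move=> hH.
have Hh : H \is hermsymmx by apply/is_hermitianmxP; rewrite expr0 scale1r -ctrmxE.
have := hermitian_normalmx Hh => /orthomx_spectralP.
set U := spectralmx H; set D := spectral_diag H => HE.
have Uu : U \in unitmx by apply: spectral_unit.
have UE : invmx U = ctrmx U.
  by rewrite ctrmxE invmx_unitary //; apply: spectral_unitarymx.
exists U, (map_mx (@complex.Re R) D); split=> //; split.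
  by rewrite -UE mulVmx.
rewrite {1}HE UE; congr (_ *m diag_mx _ *m _).
have /mxOverP Dr := hermitian_spectral_diag_real Hh.
by apply/matrixP => i j; rewrite !mxE RRe_real //; apply: Dr.
Qed.

Variable n : nat.
Implicit Types (A : 'M[C]_n) (x y : 'cV[C]_n).

Definition sform A x y : C := (ctrmx x *m A *m y) 0 0.

Lemma qformE A x : qform A x = sform A x x.
Proof. by []. Qed.

Lemma sqnormE x : sqnorm x = qform 1%:M x.
Proof. by rewrite /qform mulmx1. Qed.

Lemma sformDl A x y z : sform A (x + y) z = sform A x z + sform A y z.
Proof. by rewrite /sform ctrmxD !mulmxDl mxE. Qed.

Lemma sformDr A x y z : sform A z (x + y) = sform A z x + sform A z y.
Proof. by rewrite /sform mulmxDr mxE. Qed.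

Lemma sformZl A a x z : sform A (a *: x) z = conjc a * sform A x z.
Proof. by rewrite /sform ctrmxZ -!scalemxAl mxE. Qed.

Lemma sformZr A a x z : sform A z (a *: x) = a * sform A z x.
Proof. by rewrite /sform -scalemxAr mxE. Qed.

Lemma sform_conj A x y : conjc (sform A x y) = sform (ctrmx A) y x.
Proof.
have -> : conjc (sform A x y) = ctrmx (ctrmx x *m A *m y) 0 0.
  by rewrite /sform [RHS]mxE [in RHS]mxE; case: (_ 0 0).
by rewrite !ctrmx_mul ctrmxK mulmxA.
Qed.

Lemma qformD A B x : qform (A + B) x = qform A x + qform B x.
Proof. by rewrite /qform mulmxDr mulmxDl mxE. Qed.

Lemma qformZ a A x : qform (a *: A) x = a * qform A x.
Proof. by rewrite /qform -scalemxAr -scalemxAl mxE. Qed.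

Lemma qformN A x : qform (- A) x = - qform A x.
Proof. by rewrite -scaleN1r qformZ mulN1r. Qed.

Lemma qform_scale A a x : qform A (a *: x) = `|a| ^+ 2 * qform A x.
Proof. by rewrite !qformE sformZl sformZr mulrA -normCKC. Qed.

Lemma qform_ctrmx A x : qform (ctrmx A) x = conjc (qform A x).
Proof. by rewrite !qformE sform_conj. Qed.

Lemma qform_congr (T D : 'M[C]_n) x :
  qform (ctrmx T *m D *m T) x = qform D (T *m x).
Proof. by rewrite /qform ctrmx_mul !mulmxA. Qed.

Lemma qform_diag (d : 'rV[C]_n) x :
  qform (diag_mx d) x = \sum_k d 0 k * `|x k 0| ^+ 2.
Proof.
rewrite /qform -mulmxA mxE; apply: eq_bigr => k _.
by rewrite mul_diag_mx !mxE mulrCA; congr (_ * _); rewrite normCKC; case: (x k 0).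
Qed.

Lemma sqnorm_sum x : sqnorm x = \sum_k `|x k 0| ^+ 2.
Proof.
rewrite sqnormE -diag_const_mx qform_diag; apply: eq_bigr => k _.
by rewrite mxE mul1r.
Qed.

Lemma sqnorm_ge0 x : 0 <= sqnorm x.
Proof. by rewrite sqnorm_sum sumr_ge0 // => k _; rewrite exprn_ge0. Qed.

Lemma sqnorm_eq0 x : (sqnorm x == 0) = (x == 0).
Proof.
apply/eqP/eqP => [|->]; last by rewrite /sqnorm mulmx0 mxE.
rewrite sqnorm_sum => /eqP; rewrite psumr_eq0 => [/allP h|k _]; last by rewrite exprn_ge0.
apply/colP => k; rewrite mxE; apply/eqP.
by have := h k (mem_index_enum k); rewrite /= expf_eq0 normr_eq0.
Qed.

Lemma sqnorm_gt0 x : (0 < sqnorm x) = (x != 0).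
Proof. by rewrite lt_def sqnorm_ge0 sqnorm_eq0 andbT. Qed.

Lemma sqnorm_scale a x : sqnorm (a *: x) = `|a| ^+ 2 * sqnorm x.
Proof. by rewrite !sqnormE qform_scale. Qed.

Lemma unit_vec_scale x : x != 0 -> exists2 a : C, 0 < a & unit_vec (a *: x).
Proof.
move=> x0; exists (sqrtC (sqnorm x))^-1.
  by rewrite invr_gt0 sqrtC_gt0 sqnorm_gt0.
rewrite /unit_vec sqnorm_scale normfV exprVn -normrX sqrtCK ger0_norm ?sqnorm_ge0 //.
by rewrite mulVf // sqnorm_eq0.
Qed.
End Adjoint.

(** * Convexity and compactness of the numerical range *)

Section NumericalRange.
Variables (R : realType) (n : nat).
Local Notation C := R[i].
Implicit Types (A M : 'M[C]_n) (x y : 'cV[C]_n).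

(* Rescaling x makes the cross terms of the form real, so that along the segment
   from x to y the form is a real quadratic polynomial changing sign. *)
Lemma qform_sign_change M x y : x != 0 -> y != 0 ->
  qform M x <= 0 -> 0 <= qform M y -> exists2 z, z != 0 & qform M z = 0.
Proof.
move=> x0 y0; rewrite le_eqVlt => /predU1P[qx _|qx]; first by exists x.
rewrite le_eqVlt => /predU1P[qy|qy]; first by exists y.
(* The cross terms for [u *: x] and [y] have imaginary part Im(u d). Taking [u = conjc d] turns this
   into Im(|d|^2) = 0; if [d] vanishes, any nonzero [u] will do. *)
pose d := sform M y x - conjc (sform M x y).
pose u : C := if d == 0 then 1 else conjc d.
have u0 : u != 0.
  by rewrite /u; case: (d =P 0) => [_|/eqP d0]; rewrite ?oner_eq0 // conjc_eq0.
have qux : qform M (u *: x) < 0.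
  by rewrite qform_scale pmulr_rlt0 // exprn_gt0 // normr_gt0.
have gI : complex.Im (sform M (u *: x) y + sform M y (u *: x)) = 0.
  rewrite sformZl sformZr /u; case: (d =P 0); rewrite /d.
    move/eqP; rewrite subr_eq0 => /eqP ->; rewrite conjc1 !mul1r.
    by case: (sform M x y) => a b /=; rewrite subrr.
  by move=> _; case: (sform M x y) => a b; case: (sform M y x) => c e /=; ring.
move: gI; set g := _ + _ => gI.
have [a aE] : exists a : R, qform M (u *: x) = a%:C.
  by exists (complex.Re (qform M (u *: x))); rewrite RRe_real // ltr0_real.
have [c cE] : exists c : R, qform M y = c%:C.
  by exists (complex.Re (qform M y)); rewrite RRe_real // gtr0_real.
have gE : g = (complex.Re g)%:C by case: (g) gI => ? ? /= ->.
set b := complex.Re g in gE.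
have zE (t : R) : qform M ((1 - t)%:C *: (u *: x) + t%:C *: y) =
    ((1 - t) ^+ 2 * a + t * (1 - t) * b + t ^+ 2 * c)%:C.
  rewrite !qformE sformDl !sformDr ![sform M (_%:C *: _) _]sformZl.
  rewrite ![sform M _ (_%:C *: _)]sformZr.
  rewrite -[sform M (u *: x) (u *: x)]qformE -[sform M y y]qformE aE cE.
  rewrite !conjc_real !(rmorphD, rmorphM, rmorphXn) /= -gE /g.
  rewrite rmorphN rmorph1; ring.
have a0 : a < 0 by move: qux; rewrite aE -[0]/(0%:C) ltcR.
have c0 : 0 < c by move: qy; rewrite cE -[0]/(0%:C) ltcR.
pose p : {poly R} := (1 - 'X) ^+ 2 * a%:P + 'X * (1 - 'X) * b%:P + 'X ^+ 2 * c%:P.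
have pE t : p.[t] = (1 - t) ^+ 2 * a + t * (1 - t) * b + t ^+ 2 * c.
  by rewrite /p !hornerE.
have [|t _ /rootP pt] := @poly_ivt R p 0 1 ler01.
  by rewrite !pE; apply/andP; split; lra.
exists ((1 - t)%:C *: (u *: x) + t%:C *: y); last by rewrite zE -pE pt.
(* If the combination vanished, [y] would be a multiple of [u *: x], and its form would be
   nonpositive, against [qy]. Division by [t] is allowed since p(0) = [a] < 0. *)
apply/eqP => z0.
have t0 : t != 0.
  apply/eqP => t0; move: pt; rewrite pE t0; lra.
have yE : y = (- (1 - t) / t)%:C *: (u *: x).
  have /eqP := z0; rewrite addrC addr_eq0 => /eqP tyE.
  have tC : t%:C != 0 by rewrite -[0]/(0%:C) (inj_eq (@complexI _)).
  apply: (scalerI tC); rewrite tyE [RHS]scalerA -[t%:C * _]rmorphM mulrCA divff // mulr1.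
  by rewrite rmorphN scaleNr.
move: qy; rewrite yE qform_scale => /lt_geF/negP; apply.
by rewrite mulr_ge0_le0 ?exprn_ge0 // ltW.
Qed.

(** Identifies real 2n-space with complex n-space, so that compactness and the extreme value theorem
    for real row vectors apply to the complex unit sphere. *)
Definition vec_of_parts (v : 'rV[R]_(n + n)) : 'cV[C]_n :=
  \col_i (v 0 (lshift n i) +i* v 0 (rshift n i)).

Lemma vec_of_partsK x : vec_of_parts
  (row_mx (\row_i complex.Re (x i 0)) (\row_i complex.Im (x i 0))) = x.
Proof.
apply/colP => i; by rewrite mxE row_mxEl row_mxEr !mxE; case: (x i 0).
Qed.

Definition continuousC (V : topologicalType) (f : V -> C) :=
  continuous (fun v => complex.Re (f v)) /\ continuous (fun v => complex.Im (f v)).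

Lemma continuousC_sum (V : topologicalType) (f : 'I_n -> V -> C) :
  (forall i, continuousC (f i)) -> continuousC (fun v => \sum_i f i v).
Proof.
move=> cf; split.
  rewrite (_ : (fun _ => _) = fun v => \sum_i complex.Re (f i v)).
    by apply: continuous_big => [|i _]; [exact: add_continuous | case: (cf i)].
  by apply/funext => v; rewrite (raddf_sum (@complex.Re R : Rcomplex R -> R)).
rewrite (_ : (fun _ => _) = fun v => \sum_i complex.Im (f i v)).
  by apply: continuous_big => [|i _]; [exact: add_continuous | case: (cf i)].
by apply/funext => v; rewrite (raddf_sum (@complex.Im R : Rcomplex R -> R)).
Qed.

Lemma continuousCM (V : topologicalType) (f g : V -> C) :
  continuousC f -> continuousC g -> continuousC (fun v => f v * g v).
Proof.
move=> [fr fi] [gr gi]; split.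
  rewrite (_ : (fun _ => _) = fun v => complex.Re (f v) * complex.Re (g v)
      - complex.Im (f v) * complex.Im (g v)).
    by move=> v; apply: cvgB; apply: cvgM; [exact: fr|exact: gr|exact: fi|exact: gi].
  by apply/funext => v; case: (f v) => ? ?; case: (g v).
rewrite (_ : (fun _ => _) = fun v => complex.Re (f v) * complex.Im (g v)
    + complex.Im (f v) * complex.Re (g v)).
  by move=> v; apply: cvgD; apply: cvgM; [exact: fr|exact: gi|exact: fi|exact: gr].
by apply/funext => v; case: (f v) => ? ?; case: (g v).
Qed.

Lemma continuousC_qform A : continuousC (fun v => qform A (vec_of_parts v)).
Proof.
rewrite (_ : (fun _ => _) = fun v => \sum_j (\sum_i
    conjc (vec_of_parts v i 0) * A i j) * vec_of_parts v j 0).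
  have cv i : continuousC (fun v => vec_of_parts v i 0).
    split.
      rewrite (_ : (fun _ => _) = fun v : 'rV[R]_(n + n) => v 0 (lshift n i)).
        exact: coord_continuous.
      by apply/funext => v; rewrite mxE.
    rewrite (_ : (fun _ => _) = fun v : 'rV[R]_(n + n) => v 0 (rshift n i)).
      exact: coord_continuous.
    by apply/funext => v; rewrite mxE.
  apply: continuousC_sum => j; apply: continuousCM => //.
  apply: continuousC_sum => i; apply: continuousCM;
    last by split => v; exact: cst_continuous.
  have [cr ci] := cv i; split.
    rewrite (_ : (fun _ => _) = fun v => complex.Re (vec_of_parts v i 0)) //.
    by apply/funext => v; case: (vec_of_parts v i 0).
  rewrite (_ : (fun _ => _) = fun v => - complex.Im (vec_of_parts v i 0)).
    by move=> v; exact: (cvgN (ci v)).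
  by apply/funext => v; case: (vec_of_parts v i 0).
apply/funext => v; rewrite /qform mxE; apply: eq_bigr => j _; congr (_ * _).
rewrite mxE; apply: eq_bigr => i _; congr (_ * _).
by rewrite !mxE.
Qed.

(** The unit sphere is closed and lies in the cube of side [-1, 1], hence is compact; the continuous
    function [f], the squared modulus of the form, attains its minimum there. Positivity of [n]
    makes the sphere nonempty. *)
Lemma qform_norm_min A : (0 < n)%N -> exists2 x, unit_vec x &
  forall y, unit_vec y -> `|qform A x| <= `|qform A y|.
Proof.
move=> n0.
pose N2 v := complex.Re (qform 1%:M (vec_of_parts v)).
pose S := [set v : 'rV[R]_(n + n) | N2 v = 1]%classic.
have SP v : S v <-> unit_vec (vec_of_parts v).
  rewrite /S /= /N2 -sqnormE /unit_vec; split => [h|->//].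
  by rewrite -[LHS]RRe_real ?h // ger0_real // sqnorm_ge0.
pose f v := complex.Re (qform A (vec_of_parts v)) * complex.Re (qform A (vec_of_parts v)) +
            complex.Im (qform A (vec_of_parts v)) * complex.Im (qform A (vec_of_parts v)).
have fE v : (f v)%:C = `|qform A (vec_of_parts v)| ^+ 2.
  by rewrite -add_Re2_Im2 !expr2.
have cf : continuous f.
  have [cr ci] := continuousC_qform A; move=> v.
  exact: (cvgD (cvgM (cr v) (cr v)) (cvgM (ci v) (ci v))).
have S0 : (S !=set0)%classic.
  pose x : 'cV[C]_n := delta_mx (Ordinal n0) 0.
  exists (row_mx (\row_i complex.Re (x i 0)) (\row_i complex.Im (x i 0))).
  apply/SP; rewrite vec_of_partsK /unit_vec sqnorm_sum (bigD1 (Ordinal n0)) //=.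
  rewrite mxE !eqxx normr1 expr1n big1 ?addr0 // => i /negPf ni.
  by rewrite mxE ni normr0 expr0n.
have cS : compact S.
  pose box := [set v : 'rV[R]_(n + n) | forall i, `[(-1 : R), 1]%classic (v ord0 i)]%classic.
  have cbox : compact box.
    apply: (@rV_compact R _ (fun=> `[(-1 : R), 1]%classic)) => i.
    exact: segment_compact.
  have Scl : closed S.
    have [cN _] := continuousC_qform 1%:M.
    apply: (@preimage_closed _ _ N2 [set r | r = 1]%classic) => [v _|].
      exact: cN.
    exact: closed_eq.
  have -> : S = (box `&` S)%classic.
    apply/seteqP; split=> [v Sv|v []//]; split=> // k.
    have /SP := Sv; rewrite /unit_vec sqnorm_sum => s1.
    have le1 i : `|vec_of_parts v i 0| ^+ 2 <= 1.
      by rewrite -s1 (bigD1 i) //= lerDl sumr_ge0 // => j _; rewrite exprn_ge0.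
    have le2 i : v 0 (lshift n i) ^+ 2 + v 0 (rshift n i) ^+ 2 <= 1.
      by have := le1 i; rewrite mxE -add_Re2_Im2 /= -[1]/(1%:C) lecR.
    rewrite /= in_itv /=; case: (split_ordP k) => i ->; have := le2 i; nra.
  exact: compact_closedI.
have [v vS vmin] := EVT_min_rV S0 cS (continuous_subspaceT cf).
exists (vec_of_parts v); first by apply/SP; rewrite inE in vS.
move=> y yu; rewrite -(@ler_pXn2r _ 2) ?nnegrE ?normr_ge0 // -fE.
rewrite -[y]vec_of_partsK -fE lecR; apply: vmin; rewrite inE.
by apply/SP; rewrite vec_of_partsK.
Qed.
End NumericalRange.

(** * Separation of the numerical range from the origin *)

Section HalfPlane.
Variables (R : realType) (n : nat).
Local Notation C := R[i].
Implicit Types (A M : 'M[C]_n) (x y : 'cV[C]_n).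

(* The point of the numerical range closest to the origin separates it from the origin. *)
Lemma sectorial_half_plane A : (0 < n)%N -> sectorial A ->
  exists2 w : C, w != 0 & forall x, x != 0 -> 0 < complex.Re (conjc w * qform A x).
Proof.
move=> n0 sA; have [x0 x0u x0min] := qform_norm_min A n0.
set w0 := qform A x0 in x0min.
have w00 : w0 != 0 by apply/eqP => h; apply: sA; exists x0.
exists w0 => // x xn0.
have [a a0 yu] := unit_vec_scale xn0; set y := a *: x in yu.
have [a' aE] : exists a', a = a'%:C.
  by exists (complex.Re a); rewrite RRe_real // gtr0_real.
have a'0 : 0 < a' by move: a0; rewrite aE -[0]/(0%:C) ltcR.
suff : 0 < complex.Re (conjc w0 * qform A y).
  rewrite /y qform_scale aE mulrCA ger0_norm ?ler0c ?ltW // -rmorphXn.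
  case: (conjc w0 * qform A x) => p q; rewrite /= mul0r subr0.
  by rewrite pmulr_rgt0 // exprn_gt0.
rewrite ltNge; apply/negP => D0.
set w := qform A y in D0.
have u1 z : unit_vec z -> forall c : C, qform (c%:M) z = c.
  by move=> zu c; rewrite -scalemx1 qformZ -sqnormE zu mulr1.
have unz z : unit_vec z -> z != 0 by move=> zu; rewrite -sqnorm_gt0 zu ltr01.
pose N0 := complex.Re w0 ^+ 2 + complex.Im w0 ^+ 2.
pose N := complex.Re w ^+ 2 + complex.Im w ^+ 2.
have N0gt : 0 < N0 by rewrite -ltcR /N0 add_Re2_Im2 exprn_gt0 // normr_gt0.
have N_ge : 0 <= N by rewrite addr_ge0 // sqr_ge0.
(* This [s] minimizes (1-s)^2 N0 + s^2 N, which bounds |c|^2 from above for the point [c] of the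
   segment from [w0] to [w], because Re(conj w0 w) <= 0. The minimum (1-s) N0 is below N0. *)
pose s := N0 / (N0 + N).
have sE : s * (N0 + N) = N0 by rewrite /s mulfVK // gt_eqF //; lra.
have s0 : 0 < s by rewrite /s divr_gt0 //; lra.
have s1 : s <= 1 by rewrite /s ler_pdivrMr; lra.
pose c := (1 - s)%:C * w0 + s%:C * w.
have ww0 : w - w0 != 0.
  rewrite subr_eq0; apply/eqP => ww; move: D0 N0gt; rewrite ww /N0.
  by case: (w0) => p q /=; nra.
(* The form of [M] is -s|w-w0|^2 at [x0] and (1-s)|w-w0|^2 at [y]. A zero in between is a vector
   where the form of [A] equals [c], once normalized: this is the Toeplitz-Hausdorff step. *)
pose M := conjc (w - w0) *: (A - c%:M).
have ME z : unit_vec z -> qform M z = conjc (w - w0) * (qform A z - c).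
  by move=> zu; rewrite /M qformZ qformD qformN u1.
have [z zn0 qz] : exists2 z, z != 0 & qform M z = 0.
  apply: (@qform_sign_change _ _ M x0 y); rewrite ?unz // ME // -?/w0 -?/w.
    have -> : conjc (w - w0) * (w0 - c) = - (s%:C * `|w - w0| ^+ 2).
      rewrite normCKC -[Num.conj _]/(conjc _) /c [(1 - s)%:C]rmorphB rmorph1; ring.
    by rewrite oppr_le0 mulr_ge0 // ?exprn_ge0 // ler0c ltW.
  have -> : conjc (w - w0) * (w - c) = (1 - s)%:C * `|w - w0| ^+ 2.
    rewrite normCKC -[Num.conj _]/(conjc _) /c [(1 - s)%:C]rmorphB rmorph1; ring.
  by rewrite mulr_ge0 // ?exprn_ge0 // ler0c subr_ge0.
have [b b0 bu] := unit_vec_scale zn0.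
have : qform A (b *: z) = c.
  apply/eqP; rewrite -subr_eq0; move: (ME _ bu); rewrite qform_scale qz mulr0.
  by move=> /esym/eqP; rewrite mulf_eq0 conjc_eq0 (negPf ww0).
move=> qc; have := x0min _ bu; rewrite qc.
rewrite -(@ler_pXn2r _ 2) ?nnegrE ?normr_ge0 // -!add_Re2_Im2 lecR -/N0.
move: D0 N0gt N_ge sE; rewrite /c /N /N0; case: (w0) => p q; case: (w) => r t /=.
move=> D0 N0gt N_ge sE.
rewrite !mul0r !addr0 !subr0; apply/negP; rewrite -ltNge.
have -> : ((1 - s) * p + s * r) ^+ 2 + ((1 - s) * q + s * t) ^+ 2 =
  (1 - s) ^+ 2 * (p ^+ 2 + q ^+ 2) + s * (1 - s) * 2 * (p * r + q * t) +
  s * (s * (r ^+ 2 + t ^+ 2)) by ring.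
have -> : s * (r ^+ 2 + t ^+ 2) = (1 - s) * (p ^+ 2 + q ^+ 2).
  by rewrite -[X in _ = (1 - s) * X]sE; move: sE; set X := p ^+ 2 + _; set Y := r ^+ 2 + _; nra.
have : s * (1 - s) * 2 * (p * r + q * t) <= 0.
  rewrite mulr_ge0_le0 //; last by move: D0; rewrite mulNr opprK.
  by apply: mulr_ge0 => //; apply: mulr_ge0; lra.
have := mulr_gt0 s0 N0gt; lra.
Qed.
End HalfPlane.

(** * Polar form, convex cones and arguments in the complex plane *)

Section Polar.
Variable R : realType.
Local Notation C := R[i].
Implicit Types (w z : C) (a b t : R).

Lemma expiD a b : expi (a + b) = expi a * expi b.
Proof. by rewrite /expi cosD sinD; simpc; rewrite [sin a * _ + _]addrC. Qed.

Lemma expi0 : expi 0 = 1 :> C.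
Proof. by rewrite /expi cos0 sin0. Qed.

Lemma expiN a : expi (- a) = conjc (expi a).
Proof. by rewrite /expi cosN sinN. Qed.

Lemma norm_expi a : `|expi a| = 1.
Proof. by rewrite normc_def /= cos2Dsin2 sqrtr1. Qed.

Lemma expi_conj_mul a : expi a * conjc (expi a) = 1.
Proof. by rewrite -expiN -expiD subrr expi0. Qed.

Lemma polar z : exists2 t, - pi <= t <= pi & z = `|z| * expi t.
Proof.
have [->|z0] := eqVneq z 0.
  by exists 0; rewrite ?oppr_le0 ?pi_ge0 // normr0 mul0r.
move: z0; case: z => p q; rewrite -normr_gt0 normc_def -[0]/(0%:C) ltcR /=.
set r := Num.sqrt _ => r0.
have r2 : r ^+ 2 = p ^+ 2 + q ^+ 2 by rewrite /r sqr_sqrtr // addr_ge0 // sqr_ge0.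
have pr : -1 <= p / r <= 1.
  by rewrite ler_pdivlMr // ler_pdivrMr //; apply/andP; split; nra.
have cE : r * cos (acos (p / r)) = p by rewrite acosK ?in_itv //= mulrC divfK // gt_eqF.
have sE : r * sin (acos (p / r)) = `|q|.
  rewrite sin_acos // -[X in X * _](@gtr0_norm _ r) // -sqrtr_sqr -sqrtrM ?sqr_ge0 //.
  rewrite mulrBr mulr1 expr_div_n [_ * (_ / _)]mulrC divfK ?expf_neq0 ?gt_eqF //.
  by rewrite r2 [p ^+ 2 + _]addrC addrK sqrtr_sqr.
have := acos_ge0 pr; have := acos_lepi pr => tpi t0.
have [q0|q0] := leP 0 q.
  exists (acos (p / r)); first by apply/andP; split; lra.
  by rewrite /expi; simpc; rewrite cE sE ger0_norm.
exists (- acos (p / r)); first by apply/andP; split; lra.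
by rewrite /expi cosN sinN; simpc; rewrite cE sE ltr0_norm // opprK.
Qed.

(** Cosine is even and strictly decreasing on [0, pi]; this converts bounds on real parts into
    bounds on arguments. *)
Lemma le_cos_abs a b : - pi <= a <= pi -> 0 <= b <= pi ->
  (cos b <= cos a) = (`|a| <= b).
Proof.
move=> /andP[a1 a2] b0; rewrite -(cos_norm a).
rewrite !leNgt ltr_cos //; rewrite in_itv //=.
by rewrite normr_ge0 ler_norml a1.
Qed.

Lemma Re_sum (I : finType) (F : I -> C) :
  complex.Re (\sum_i F i) = \sum_i complex.Re (F i).
Proof. by rewrite (raddf_sum (@complex.Re R : Rcomplex R -> R)). Qed.

(** Rotating by [- mid] makes the cone symmetric about the positive real axis, with half-angle [d] <
    pi/2. Then |w| cos d <= (sum of c_k) cos d <= Re w' = |w| cos t by the triangle inequality, so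
    |t| <= d. *)
Lemma cone_polar (I : finType) (c phi : I -> R) (m M : R) :
  m <= M -> M - m < pi -> (forall k, 0 <= c k) -> (forall k, m <= phi k <= M) ->
  let w := \sum_k (c k)%:C * expi (phi k) in
  exists2 t, m <= t <= M & w = `|w| * expi t.
Proof.
move=> mM Mm c0 phiP w.
pose mid := (m + M) / 2; pose d := (M - m) / 2.
have [w0|wn0] := eqVneq w 0.
  by exists mid; rewrite ?w0 ?normr0 ?mul0r //; apply/andP; split; rewrite /mid; lra.
pose w' := w * expi (- mid).
have w'E : w' = \sum_k (c k)%:C * expi (phi k - mid).
  by rewrite /w' mulr_suml; apply: eq_bigr => k _; rewrite -mulrA -expiD.
have nw' : `|w'| = `|w| by rewrite normrM norm_expi mulr1.
have [t tpi tE] := polar w'.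
have wE : w = `|w| * expi (t + mid).
  rewrite expiD mulrA -nw' -tE /w' -mulrA -expiD [- mid + _]addrC subrr.
  by rewrite expi0 mulr1.
exists (t + mid) => //.
have pi0 : 0 < pi :> R := pi_gt0 R.
suff : `|t| <= d by rewrite ler_norml /d /mid => /andP[h1 h2]; apply/andP; split; lra.
have d0pi : 0 <= d <= pi by rewrite /d; apply/andP; split; lra.
rewrite -le_cos_abs //.
pose r := Num.sqrt (complex.Re w' ^+ 2 + complex.Im w' ^+ 2).
have nE : `|w'| = r%:C by rewrite normc_def.
have r0 : 0 < r by rewrite -ltcR -nE nw' normr_gt0.
have cosd : 0 <= cos d by apply: cos_ge0_pihalf; rewrite /d; apply/andP; split; lra.
rewrite -(ler_pM2l r0).
have -> : r * cos t = complex.Re w'.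
  by rewrite [in RHS]tE nE /expi; simpc.
have rle : r <= \sum_k c k.
  rewrite -lecR -nE w'E rmorph_sum /=; apply: le_trans (ler_norm_sum _ _ _) _.
  by apply: ler_sum => k _; rewrite normrM norm_expi mulr1 ger0_norm // ler0c.
apply: le_trans (ler_wpM2r cosd rle) _.
rewrite w'E Re_sum mulr_suml; apply: ler_sum => k _.
rewrite /= mul0r subr0; apply: ler_wpM2l => //.
have /andP[h1 h2] := phiP k.
rewrite le_cos_abs // ?ler_norml /mid /d; apply/andP; split; lra.
Qed.

(** The map z -> - conj z reflects in the imaginary axis and sends argument t to pi - t modulo 2 pi.
    The absolute value of the new angle is therefore pi - |t|, which exceeds [theta]. *)
Lemma angle_outside (theta t : R) (r : R) : 0 < r -> 0 <= theta < pi ->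
  - pi + theta < t < pi - theta ->
  ~ (- theta < angle (- conjc (r%:C * expi t)) < theta).
Proof.
move=> r0 /andP[th0 thpi] /andP[t1 t2].
have -> : - conjc (r%:C * expi t) = (- (r * cos t)) +i* (r * sin t).
  by rewrite /expi; simpc.
rewrite /angle.
case: eqP => [[/eqP h1 /eqP h2]|_] /=.
  exfalso; move: h1 h2; rewrite oppr_eq0 !mulf_eq0 (gt_eqF r0) /= => /eqP h1 /eqP h2.
  by have := cos2Dsin2 t; rewrite h1 h2 !expr0n /= addr0 => /eqP; rewrite eq_sym oner_eq0.
have -> : Num.sqrt ((- (r * cos t)) ^+ 2 + (r * sin t) ^+ 2) = r.
  rewrite sqrrN !exprMn -mulrDr cos2Dsin2 mulr1 sqrtr_sqr gtr0_norm //.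
have -> : - (r * cos t) / r = - cos t by rewrite mulNr mulrAC divff ?gt_eqF // mul1r.
have cI : -1 <= - cos t <= 1 by rewrite lerN2 cos_le1 lerNl cos_geN1.
have ge : theta <= acos (- cos t).
  have ac0 := acos_ge0 cI; have acpi := acos_lepi cI.
  rewrite leNgt; apply/negP => lt.
  have : cos theta < - cos t.
    rewrite -[X in _ < X]acosK ?in_itv //= ltr_cos // in_itv /=; apply/andP; split=> //; lra.
  rewrite ltrNr -[- cos theta]cosDpi -(cosN (theta + pi)).
  have -> : cos (- (theta + pi)) = cos (pi - theta).
    by rewrite -cosD2pi; congr cos; rewrite mulr2n; ring.
  apply/negP; rewrite -leNgt le_cos_abs; try (apply/andP; split; lra).
  by rewrite ler_norml; apply/andP; split; lra.
by case: ifP => _ /andP[h1 h2]; lra.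
Qed.
End Polar.

(** * Existence of phases, and bounds from singular values and phases *)

Section Phases.
Variables (R : realType) (n : nat).
Local Notation C := R[i].
Implicit Types (A B H T : 'M[C]_n) (x y : 'cV[C]_n).

(** Positive factors go into the congruence: [T] is replaced by diag(sqrt r_k) T, the real diagonal
    factor being its own adjoint and commuting with diag(e_k). *)
Lemma congr_diag_absorb T (r : 'I_n -> R) (e : 'I_n -> C) : T \in unitmx ->
  (forall k, 0 < r k) ->
  exists2 S : 'M[C]_n, S \in unitmx &
    ctrmx T *m diag_mx (\row_k ((r k)%:C * e k)) *m T =
    ctrmx S *m diag_mx (\row_k e k) *m S.
Proof.
move=> Tu r0; pose q : 'rV[R]_n := \row_k Num.sqrt (r k).
pose Q := diag_mx (map_mx (real_complex R) q).
exists (Q *m T).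
  rewrite unitmx_mul Tu andbT unitmxE det_diag unitfE.
  apply/prodf_neq0 => k _; rewrite !mxE -[0]/(0%:C) (inj_eq (@complexI _)).
  by rewrite gt_eqF // sqrtr_gt0.
rewrite ctrmx_mul ctrmx_real_diag -/Q !mulmxA; congr (_ *m _).
rewrite -!mulmxA; congr (_ *m _).
rewrite [X in _ *m X]mulmx_diag mulmx_diag; congr diag_mx; apply/rowP => k.
rewrite !mxE mulrCA [RHS]mulrC -rmorphM -expr2 sqr_sqrtr; last exact: ltW.
by rewrite mulrC.
Qed.

Lemma posdef_factor H : ctrmx H = H -> (forall x, x != 0 -> 0 < qform H x) ->
  exists2 S : 'M[C]_n, S \in unitmx & H = ctrmx S *m S.
Proof.
move=> hH posH; have [U [d [Uu [UU HE]]]] := hermitian_diagonalization hH.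
have d0 k : 0 < d 0 k.
  (* Since [U *m x] is the k-th basis vector, the form of [H] at [x] is exactly the eigenvalue
     [d 0 k]. *)
  pose x : 'cV[C]_n := invmx U *m delta_mx k 0.
  have xn0 : x != 0.
    apply/eqP => /(congr1 (mulmx U)); rewrite mulmx0 mulKVmx // => /colP/(_ k).
    by rewrite !mxE !eqxx => /eqP; rewrite oner_eq0.
  have := posH _ xn0; rewrite HE qform_congr mulKVmx // qform_diag (bigD1 k) //=.
  rewrite big1 => [|i /negPf ik]; last by rewrite !mxE ik normr0 expr0n mulr0.
  by rewrite !mxE !eqxx normr1 expr1n mulr1 addr0 -[0]/(0%:C) ltcR.
have [S Su SE] := congr_diag_absorb (fun=> 1) Uu d0.
exists S => //; move: SE.
have -> : \row_k ((d 0 k)%:C * 1) = map_mx (real_complex R) d.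
  by apply/rowP => k; rewrite !mxE mulr1.
rewrite -HE => ->; have -> : diag_mx (\row__ 1) = 1%:M :> 'M[C]_n.
  by rewrite -diag_const_mx; congr diag_mx; apply/rowP => k; rewrite !mxE.
by rewrite mulmx1.
Qed.

Lemma accretive_diagonalization B :
  (forall x, x != 0 -> 0 < complex.Re (qform B x)) ->
  exists (T : 'M[C]_n) (l : 'I_n -> R), T \in unitmx /\
    B = ctrmx T *m diag_mx (\row_k expi (atan (l k))) *m T.
Proof.
move=> posB.
pose H := 2^-1 *: (B + ctrmx B).
pose K := (- 'i%C) *: (2^-1 *: (B - ctrmx B)).
have conj2 : conjc (2^-1 : C) = 2^-1 by rewrite conjc_inv conjc_nat.
have conji : conjc (- 'i%C : C) = 'i%C by simpc.
have hH : ctrmx H = H by rewrite ctrmxZ ctrmxD ctrmxK conj2 addrC.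
have hK : ctrmx K = K.
  rewrite !ctrmxZ ctrmxD ctrmxN ctrmxK conj2 conji.
  by rewrite -[ctrmx B - B]opprB !scalerN -scaleNr.
have HK : B = H + 'i%C *: K.
  rewrite /H /K [_ *: (- _ *: _)]scalerA mulrN -expr2 sqr_i opprK scale1r -scalerDr.
  rewrite addrACA subrr addr0 -mulr2n -[B *+ 2]scaler_nat scalerA mulVf ?scale1r //.
  by rewrite pnatr_eq0.
have [S Su HE] : exists2 S : 'M[C]_n, S \in unitmx & H = ctrmx S *m S.
  apply: posdef_factor => // x x0.
  rewrite /H qformZ qformD qform_ctrmx addcJ mulrA mulVf ?pnatr_eq0 // mul1r.
  by rewrite -[0]/(0%:C) ltcR posB.
(* Congruence by the inverse of [S] takes [H] to the identity. The unitary [V] diagonalizing [K']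
   preserves the identity, so [V *m S] reduces [H] and [K] simultaneously. *)
pose K' := ctrmx (invmx S) *m K *m invmx S.
have hK' : ctrmx K' = K' by rewrite /K' !ctrmx_mul ctrmxK hK mulmxA.
have [V [l [Vu [VV KE]]]] := hermitian_diagonalization hK'.
pose T := V *m S.
have Tu : T \in unitmx by rewrite unitmx_mul Vu.
have TH : H = ctrmx T *m T.
  by rewrite HE /T ctrmx_mul mulmxA -[_ *m ctrmx V *m _]mulmxA VV mulmx1.
have TK : K = ctrmx T *m diag_mx (map_mx (real_complex R) l) *m T.
  have -> : K = ctrmx S *m K' *m S.
    by rewrite /K' ctrmx_inv !mulmxA mulmxV ?ctrmx_unit // mul1mx mulmxKV.
  by rewrite KE /T ctrmx_mul !mulmxA.
(* Polar form of the diagonal entries: 1 + i l = sqrt(1 + l^2) e^{i atan l}. *)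
have BE : B = ctrmx T *m diag_mx (\row_k
    ((Num.sqrt (1 + l 0 k ^+ 2))%:C * expi (atan (l 0 k)))) *m T.
  rewrite {1}HK TH {1}TK -{1}[ctrmx T]mulmx1 scalemxAl scalemxAr -mulmxDl -mulmxDr.
  congr (_ *m _ *m _); rewrite -diag_const_mx -linearZ -linearD /=.
  congr diag_mx; apply/rowP => k; rewrite !mxE.
  have r0 : Num.sqrt (1 + l 0 k ^+ 2) != 0.
    by rewrite gt_eqF // sqrtr_gt0 ltr_pwDl // sqr_ge0.
  have c0 : cos (atan (l 0 k)) != 0 by rewrite cos_atan invr_eq0.
  have := atanK (l 0 k); rewrite /tan => /(canRL (divfK c0)) sE.
  rewrite /expi sE cos_atan; simpc.
  by rewrite divff // mulrCA divff // mulr1.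
have [k|T' T'u T'E] := congr_diag_absorb (fun k => expi (atan (l 0 k))) Tu
    (r := fun k => Num.sqrt (1 + l 0 k ^+ 2)).
  by rewrite sqrtr_gt0 ltr_pwDl // sqr_ge0.
by exists T', (fun k => l 0 k); split; rewrite // -T'E.
Qed.

Lemma expiD2pi (t : R) : expi (t + pi *+ 2) = expi t.
Proof. by rewrite /expi cosD2pi sinD2pi. Qed.

Lemma sectorial_phases B : (0 < n)%N -> sectorial B ->
  exists phi imin imax, phases B phi imin imax.
Proof.
move=> n0 sB; have [w w0 wP] := sectorial_half_plane n0 sB.
have [om /andP[om1 om2] wE] := polar w.
(* Rotating [B] back by the argument [om] of the separating point [w] makes its form have positive
   real part; the phases of [B] are then [om + atan (l k)], and their spread is below pi because
   atan takes values in (-pi/2, pi/2). *)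
have [x x0|T [l [Tu TE]]] := @accretive_diagonalization (conjc (expi om) *: B).
  have := wP _ x0; rewrite qformZ.
  pose r := Num.sqrt (complex.Re w ^+ 2 + complex.Im w ^+ 2).
  have r0 : 0 < r by rewrite -ltcR -normc_def normr_gt0.
  have -> : conjc w * qform B x = r%:C * (conjc (expi om) * qform B x).
    rewrite mulrA; congr (_ * _); rewrite [in LHS]wE normc_def -/r.
    by case: (expi om) => c d; simpc.
  case: (conjc (expi om) * qform B x) => p q /=.
  by rewrite mul0r subr0 pmulr_rgt0.
pose k0 := Ordinal n0.
pose imin := [arg min_(k < k0) l k]%O; pose imax := [arg max_(k > k0) l k]%O.
have lP k : atan (l imin) <= atan (l k) <= atan (l imax).
  rewrite /imin /imax; case: arg_minP => // i _ /(_ k isT) h1.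
  by case: arg_maxP => // j _ /(_ k isT) h2; rewrite !le_atan.
have pi0 := pi_gt0 R.
have h1 := atan_gtNpi2 (l imin); have h2 := atan_ltpi2 (l imax).
have h3 := atan_gtNpi2 (l imax); have h4 := atan_ltpi2 (l imin).
(* The shift [e] brings the midpoint of the extreme phases into (-pi, pi]. One turn at most is
   needed, as |om| <= pi and the mean of the two arctangents is below pi/2 in absolute value. *)
have [e eE eP] : exists2 e : R, forall t, expi (t + e) = expi t :> C &
    - pi < om + (atan (l imin) + atan (l imax)) / 2 + e <= pi.
  set c := om + _.
  have [c1|c1] := leP c (- pi).
    exists (pi *+ 2); first exact: expiD2pi.
    by rewrite mulr2n; apply/andP; split; rewrite /c in c1 *; lra.
  have [c2|c2] := leP c pi.
    by exists 0 => [t|]; rewrite addr0 // c1.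
  exists (- (pi *+ 2)) => [t|]; first by rewrite -[RHS]expiD2pi -[LHS]expiD2pi subrK expiD2pi.
  by rewrite mulr2n; apply/andP; split; rewrite /c in c2 *; lra.
exists (fun k => om + atan (l k) + e), imin, imax.
exists T; split=> //; split; [|split; [|split]].
- have -> : B = expi om *: (conjc (expi om) *: B).
    by rewrite scalerA expi_conj_mul scale1r.
  rewrite TE scalemxAl scalemxAr; congr (_ *m _ *m _).
  rewrite -linearZ /=; congr diag_mx; apply/rowP => k.
  by rewrite !mxE eE expiD.
- by move=> k; rewrite !lerD2r !lerD2l.
- lra.
- by move: eP => /andP[e1 e2]; apply/andP; split; lra.
Qed.

(** In a unitary eigenbasis of [ctrmx B *m B], the squared norm of [B *m x] is a sum of squared
    coordinates weighted by eigenvalues, each at most s^2. *)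
Lemma sigma_max_bound B (s : R) x : is_sigma_max B s ->
  sqnorm (B *m x) <= (s ^+ 2)%:C * sqnorm x.
Proof.
move=> [s0 [_ smax]].
have -> : sqnorm (B *m x) = qform (ctrmx B *m B) x.
  by rewrite /sqnorm /qform ctrmx_mul !mulmxA.
have hBB : ctrmx (ctrmx B *m B) = ctrmx B *m B by rewrite ctrmx_mul ctrmxK.
have [U [d [Uu [UU BE]]]] := hermitian_diagonalization hBB.
have dle k : (d 0 k)%:C <= (s ^+ 2)%:C.
  (* [eigenvalue] refers to row eigenvectors, and these are the rows of [U]. *)
  apply: smax; apply/eigenvalueP; exists (row k U).
    rewrite BE -!row_mul !mulmxA (mulmx1C UU) mul1mx; apply/rowP => j.
    by rewrite mul_diag_mx !mxE.
  apply/eqP => /(congr1 (mulmx^~ (invmx U))).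
  rewrite -row_mul mulmxV // mul0mx => /rowP/(_ k); rewrite !mxE eqxx => /eqP.
  by rewrite oner_eq0.
rewrite BE qform_congr qform_diag.
have -> : sqnorm x = sqnorm (U *m x).
  by rewrite /sqnorm ctrmx_mul mulmxA -[_ *m ctrmx U *m _]mulmxA UU mulmx1.
rewrite sqnorm_sum mulr_sumr; apply: ler_sum => k _; rewrite mxE.
by rewrite ler_wpM2r ?exprn_ge0.
Qed.

Lemma qform_polar B phi imin imax y : phases B phi imin imax ->
  exists2 t, phi imin <= t <= phi imax & qform B y = `|qform B y| * expi t.
Proof.
move=> [T [_ [-> [phiP [spread _]]]]].
rewrite qform_congr qform_diag.
have -> : \sum_k (\row_k expi (phi k)) 0 k * `|(T *m y) k 0| ^+ 2 =
    \sum_k (complex.Re ((T *m y) k 0) ^+ 2 + complex.Im ((T *m y) k 0) ^+ 2)%:C *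
      expi (phi k).
  by apply: eq_bigr => k _; rewrite mxE add_Re2_Im2 mulrC.
apply: cone_polar => // [|k]; last by rewrite addr_ge0 // sqr_ge0.
by have /andP[] := phiP imax.
Qed.
End Phases.

(** * Invertibility of [1%:M + A *m B] from the combined gain and phase conditions *)

Theorem theorem6 (R : realType) (n : nat) (A B : 'M[R[i]]_n) :
  sectorial A -> sectorial B ->
  (exists theta : R, 0 <= theta < pi /\ Psi A theta /\
     (exists g s : R, is_gamma A theta g /\ is_sigma_max B s /\ g * s < 1) /\
     (forall t, Psi B t -> - pi + theta < t < pi - theta)) ->
  (1%:M + A *m B) \in unitmx.
Proof.
move=> sA sB [theta [thP [_ [[g [s [[[g0 _] gmax] [sP gs]]]] psiB]]]].
(* The determinant criterion yields a row kernel vector; passing to the transpose first makes it a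
   column kernel vector of [1%:M + A *m B]. *)
rewrite -unitmx_tr unitmxE unitfE; apply/negP => /det0P[v vn0 vE].
pose y : 'cV[R[i]]_n := v^T.
have yn0 : y != 0 by rewrite /y trmx_eq0.
have yE : (1%:M + A *m B) *m y = 0.
  by apply: trmx_inj; rewrite trmx_mul trmxK vE trmx0.
have ABy : A *m (B *m y) = - y.
  by apply/eqP; rewrite -addr_eq0 addrC mulmxA -{1}[y]mul1mx -mulmxDl yE.
set x := B *m y in ABy.
have xn0 : x != 0.
  by apply: contraNneq yn0 => x0; rewrite -oppr_eq0 -ABy x0 mulmx0.
have n0 : (0 < n)%N.
  rewrite lt0n; apply: contraNneq vn0 => n0; apply/eqP/rowP => k.
  by have := ltn_ord k; rewrite [X in (_ < X)%N]n0.
have [phi [imin [imax phP]]] := sectorial_phases n0 sB.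
have [t tP tE] := qform_polar y phP.
have qxE : qform A x = - conjc (qform B y).
  by rewrite -qform_ctrmx /qform -mulmxA ABy mulmxN mxE /x ctrmx_mul.
have [b b0 yu] := unit_vec_scale yn0.
(* Sectoriality of [B] keeps y^*By away from zero. This matters because [angle 0] is 0, which lies
   inside the excluded interval when [theta] is positive. *)
have qB0 : 0 < `|qform B y|.
  rewrite normr_gt0; apply/eqP => q0; apply: sB; exists (b *: y); split=> //.
  by rewrite qform_scale q0 mulr0.
have [a a0 xu] := unit_vec_scale xn0.
have [a' aE] : exists a', a = a'%:C.
  by exists (complex.Re a); rewrite RRe_real // gtr0_real.
have a'0 : 0 < a' by move: a0; rewrite aE -[0]/(0%:C) ltcR.
have nyE : sqnorm y = (complex.Re (sqnorm y))%:C.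
  by rewrite RRe_real // ger0_real // sqnorm_ge0.
set N := complex.Re (sqnorm y) in nyE.
have N0 : 0 < N by rewrite -ltcR -nyE sqnorm_gt0.
(* With [a'] = 1/|x| and |Ax| = |y|, this is the gain |Ax|/|x| of [A] at the normalized vector
   [a *: x]. *)
pose h := a' * Num.sqrt N.
have h0 : 0 <= h by rewrite mulr_ge0 ?sqrtr_ge0 // ltW.
have hR : Rge A theta h.
  split=> //; exists (qform A (a *: x)); split; last first.
    exists (a *: x); split=> //; congr (_, _, _).
    rewrite -/(sqnorm (A *m (a *: x))) -scalemxAr ABy sqnorm_scale.
    rewrite -[- y]scaleN1r sqnorm_scale normrN1 expr1n mul1r nyE aE.
    rewrite ger0_norm ?ler0c ?ltW // -rmorphXn -rmorphM /=.
    by rewrite /h exprMn sqr_sqrtr // ltW.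
  pose r := Num.sqrt (complex.Re (qform B y) ^+ 2 + complex.Im (qform B y) ^+ 2).
  have r0 : 0 < r by rewrite -ltcR -normc_def.
  have -> : qform A (a *: x) = - conjc ((a' ^+ 2 * r)%:C * expi t).
    rewrite qform_scale qxE tE normc_def -/r aE ger0_norm ?ler0c ?ltW // -rmorphXn.
    rewrite mulrN rmorphM; congr (- _); case: (expi t) => p q; simpc.
    by rewrite !mulrA.
  apply: angle_outside => //; first by rewrite mulr_gt0 // exprn_gt0.
  by apply: psiB; exists phi, imin, imax.
have hg := gmax _ hR.
have [s0 _] := sP.
(* Here 1 = |a x|^2 = a'^2 |By|^2 <= a'^2 s^2 |y|^2 = (h s)^2. With h <= g this contradicts g s <
   1. *)
have : 1 <= h * s.
  suff : 1 <= (h * s) ^+ 2 by have := mulr_ge0 h0 s0; nra.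
  rewrite -lecR; have := ler_wpM2l (exprn_ge0 2 (normr_ge0 a)) (sigma_max_bound y sP).
  rewrite -/x -sqnorm_scale xu nyE => le1; apply: le_trans le1 _.
  rewrite aE ger0_norm; last by rewrite ler0c ltW.
  have -> : a'%:C ^+ 2 * ((s ^+ 2)%:C * N%:C) = (a' ^+ 2 * (s ^+ 2 * N))%:C.
    by rewrite !rmorphM.
  by rewrite lecR /h !exprMn (sqr_sqrtr (ltW N0)) -mulrA [N * _]mulrC.
by have := ler_wpM2r s0 hg; lra.
Qed.
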